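(* Let $P$ be a domain that is not algebraic. Then the unit interval $[0,1]$, with its usual ordering, is a Scott-continuous retract of $P$; that is, there exist Scott-continuous maps $f\colon P\to [0,1]$ and $g\colon [0,1]\to P$ such that $f\circ g=\mathrm{id}_{[0,1]}$.
   Context: A subset $D$ of a partially ordered set is directed if it is nonempty and every two elements of $D$ have an upper bound in $D$. A dcpo (directed-complete poset) is a partially ordered set $(P,\leq)$ in which every directed subset has a supremum. The way-below relation $\ll$ on a dcpo $P$ is defined by: $x\ll y$ if for every directed subset $D$ of $P$, $y\leq \sup D$ implies $x\leq d$ for some $d\in D$. A domain is a dcpo $P$ such that for every $p\in P$ the set $\{x\in P\mid x\ll p\}$ is directed and has supremum $p$. An element $x$ of a dcpo is compact if $x\ll x$. A domain $P$ is algebraic if for every $p\in P$ the set $\{x\in P\mid x\ll x \text{ and } x\ll p\}$ is directed and has supremum $p$. A map $f\colon P\to Q$ between dcpo's is Scott-continuous if it is monotone and $f(\sup D)=\sup f(D)$ for every directed subset $D$ of $P$. A dcpo $Q$ is a Scott-continuous retract of a dcpo $P$ if there are Scott-continuous maps $f\colon P\to Q$ and $g\colon Q\to P$ with $f\circ g=\mathrm{id}_Q$. *)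

(* Defs.v *)
From mathcomp Require Import all_boot all_order all_algebra.
From mathcomp Require Import boolp classical_sets reals interval_inference.

Set Implicit Arguments.
Unset Strict Implicit.
Unset Printing Implicit Defensive.

Import Order.TTheory GRing.Theory Num.Theory.

Local Open Scope classical_set_scope.
Local Open Scope order_scope.

(* The instances required by [porderType] (a choice operator and a
   boolean-valued order) exist classically on every poset, so quantifying over
   [P : porderType d] is quantifying over all partially ordered sets. *)

Definition directed d (P : porderType d) (D : set P) : Prop :=
  D !=set0 /\
  forall x y, D x -> D y -> exists2 z, D z & x <= z /\ y <= z.

Definition dcpo d (P : porderType d) : Prop :=
  forall D : set P, directed D -> exists s, isLub D s.

(* [isLub D s] with [s] universally quantified stands for [s = sup D]: least
   upper bounds are unique, and exist for directed sets in a dcpo. *)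
Definition way_below d (P : porderType d) (x y : P) : Prop :=
  forall (D : set P) (s : P), directed D -> isLub D s -> y <= s ->
  exists2 e, D e & x <= e.

Definition compact_elt d (P : porderType d) (x : P) : Prop := way_below x x.

Definition domain d (P : porderType d) : Prop :=
  dcpo P /\
  forall p : P, let A := [set x | way_below x p] in directed A /\ isLub A p.

Definition algebraic d (P : porderType d) : Prop :=
  domain P /\
  forall p : P, let A := [set x | compact_elt x /\ way_below x p] in
  directed A /\ isLub A p.

Definition scott_continuous d (P : porderType d) d' (Q : porderType d')
    (f : P -> Q) : Prop :=
  {homo f : x y / x <= y} /\
  forall (D : set P) (s : P), directed D -> isLub D s ->
  isLub (f @` D) (f s).

(* [Q] is a retract of [P]; both are meant to be dcpos. *)
Definition scott_retract d (P : porderType d) d' (Q : porderType d') : Prop :=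
  exists (f : P -> Q) (g : Q -> P),
  [/\ scott_continuous f, scott_continuous g & f \o g = id].

(* [{i01 R}] is the subtype of [R] of the numbers between 0 and 1, ordered as
   in [R]. *)
Lemma i01_dcpo (R : realType) : dcpo {i01 R}.
Proof.
move=> D [[a Da] _].
pose E : set R := [set x%:num%R | x in D].
have E1 : ubound E 1%R by move=> _ [x _ <-].
have Ea : E a%:num%R by exists a.
have supE : has_sup E by split; [exists a%:num%R | exists 1%R].
have s0 : (0 <= sup E)%R.
  by apply: (@le_trans _ _ a%:num%R); [|exact: (ub_le_sup (proj2 supE))].
have s1 : (sup E <= 1)%R by apply: ge_sup => //; exists a%:num%R.
exists (Itv01 s0 s1); split.
- by move=> x Dx; apply: (ub_le_sup (proj2 supE)); exists x.
- move=> b ubb; apply: ge_sup; first by exists a%:num%R.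
  by move=> _ [x Dx <-]; exact: ubb.
Qed.

(* Main.v *)
Require Import Defs.
From mathcomp Require Import all_boot all_order all_algebra.
From mathcomp Require Import boolp classical_sets reals interval_inference.

(** The failure of algebraicity is witnessed by a pair [a << b] such that no
    compact element [k] satisfies [a <= k <= b]
    ([exists_compact_free_interval]): if every such pair had a compact element
    in between, the compact elements would be cofinal in the elements way below
    any given point.  As [P] is a domain, [<<] interpolates, so bisecting
    [a << b] over and over gives a family [c q], indexed by the dyadic rationals
    of [0, 1], along which [q < r] implies [c q << c r] ([bisect_way_below]).

    This chain spans the retract ([retract_of_way_below_chain]).  The section
    sends [t] to the supremum of [a] and the [c q] with [0 < q < t]; the
    retraction sends [p] to the supremum of 0 and the [q] with [c q << p].
    Scott continuity of the retraction comes from the definition of [<<] and the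
    density of the chain.  That the composite on [0, 1] does not exceed the
    identity is where compact elements must be absent: if [c q] is way below the
    image of some [t <= q], then [c q <= a], or [c q <= c r] with [r < t <= q];
    as [a << c q] and [c r << c q], this would make [c q] compact. *)

Set Implicit Arguments.
Unset Strict Implicit.
Unset Printing Implicit Defensive.

Import Order.TTheory GRing.Theory Num.Theory.

Local Open Scope classical_set_scope.
Local Open Scope ring_scope.

(** * The way-below relation *)

Lemma way_below_le d (P : porderType d) (x y : P) :
  way_below x y -> (x <= y)%O.
Proof.
move=> /(_ [set y] y) [].
- by split=> [|u v -> ->]; exists y.
- by split=> [u -> //|b]; apply.
- exact: lexx.
by move=> _ ->.
Qed.

Lemma way_below_le_trans d (P : porderType d) (x y z : P) :
  way_below x y -> (y <= z)%O -> way_below x z.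
Proof. by move=> xy yz D s dD Ds zs; apply: (xy D s dD Ds); apply: le_trans zs. Qed.

Lemma le_way_below_trans d (P : porderType d) (x y z : P) :
  (x <= y)%O -> way_below y z -> way_below x z.
Proof.
by move=> xy yz D s dD Ds zs; have [e De /(le_trans xy)] := yz D s dD Ds zs; exists e.
Qed.

Lemma way_below_trans d (P : porderType d) (x y z : P) :
  way_below x y -> way_below y z -> way_below x z.
Proof. by move=> /way_below_le; exact: le_way_below_trans. Qed.

(** The set of [u] with [u << z << y] for some [z] is directed with supremum
    [y], so [x << y] puts [x] below one of its elements. *)
Lemma way_below_interpolation d (P : porderType d) (x y : P) :
  domain P -> way_below x y -> exists z, way_below x z /\ way_below z y.
Proof.
move=> [_ domP] xy.
pose D := [set u : P | exists2 z, way_below u z & way_below z y].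
have dD : directed D.
  split.
    have [[[z zy] _] _] := domP y.
    have [[[u uz] _] _] := domP z.
    by exists u, z.
  move=> u v [zu uzu zuy] [zv vzv zvy].
  have [[_ dy] _] := domP y.
  have [z zy [zuz zvz]] := dy _ _ zuy zvy.
  have [[_ dz] _] := domP z.
  have [w wz [uw vw]] := dz _ _ (way_below_le_trans uzu zuz)
    (way_below_le_trans vzv zvz).
  by exists w => //; exists z.
have Dy : isLub D y.
  split=> [u [z uz zy]|b ub].
    exact: le_trans (way_below_le uz) (way_below_le zy).
  have [_ [_ leasty]] := domP y; apply: leasty => z zy.
  have [_ [_ leastz]] := domP z; apply: leastz => u uz.
  by apply: ub; exists z.
have [u [z uz zy] xu] := xy D y dD Dy (lexx y).
by exists z; split=> //; exact: le_way_below_trans uz.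
Qed.

(** Contrapositive: if every [x << y] has a compact element between them, then
    each set of elements way below [p] has its compact members as a cofinal
    subset, which inherits directedness and the supremum. *)
Lemma exists_compact_free_interval d (P : porderType d) :
  domain P -> ~ algebraic P ->
  exists a b : P, way_below a b /\
    forall k, (a <= k)%O -> (k <= b)%O -> ~ compact_elt k.
Proof.
move=> domP; apply: contra_notP => /forallNP none.
have compact_between x y : way_below x y ->
    exists k : P, [/\ (x <= k)%O, compact_elt k & way_below k y].
  move=> xy; have /forallNP/(_ y)/not_andP[//|] := none x.
  move=> /existsNP[k]; do 2 move=> /not_implyP[?]; move=> /contrapT ck.
  by exists k; split=> //; exact: way_below_le_trans ck _.
split=> // p; have [_ /(_ p) [[[x xp] dp] [_ leastp]]] := domP.
split.
  split; first by have [k [_ ck kp]] := compact_between _ _ xp; exists k.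
  move=> u v [_ up] [_ vp]; have [w wp [uw vw]] := dp _ _ up vp.
  have [k [wk ck kp]] := compact_between _ _ wp.
  by exists k => //; split; apply: le_trans wk.
split=> [k [_ /way_below_le //]|b ubb].
apply: leastp => y yp; have [k [yk ck kp]] := compact_between _ _ yp.
by apply: le_trans yk _; apply: ubb.
Qed.

(** * Bisecting an interval *)

(** The value of the chain at the dyadic number [k / 2 ^ n], where [m] chooses
    interpolants and the endpoints sit at 0 and 1. *)
Fixpoint bisect (T : Type) (m : T -> T -> T) (a b : T) (n k : nat) : T :=
  if n is n'.+1 then
    if odd k then m (bisect m a b n' k./2) (bisect m a b n' k./2.+1)
    else bisect m a b n' k./2
  else if k is 0%N then a else b.

Lemma bisect_refine (T : Type) (m : T -> T -> T) a b e n k :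
  bisect m a b (e + n) (k * 2 ^ e)%N = bisect m a b n k.
Proof.
elim: e => [|e IH]; first by rewrite muln1.
by rewrite addSn /= expnS mulnCA oddM /= mul2n doubleK IH.
Qed.

Lemma bisect_step d (P : porderType d) (m : P -> P -> P) (a b : P) n k :
  (forall x y, way_below x y -> way_below x (m x y) /\ way_below (m x y) y) ->
  way_below a b -> (k < 2 ^ n)%N ->
  way_below (bisect m a b n k) (bisect m a b n k.+1).
Proof.
move=> mP ab; elim: n k => [|n IH] k; first by case: k.
rewrite expnS mul2n -ltn_half_double => /IH/mP[low high] /=.
by rewrite uphalf_half; case: (odd k).
Qed.

Lemma bisect_mono d (P : porderType d) (m : P -> P -> P) (a b : P) n k l :
  (forall x y, way_below x y -> way_below x (m x y) /\ way_below (m x y) y) ->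
  way_below a b -> (k < l)%N -> (l <= 2 ^ n)%N ->
  way_below (bisect m a b n k) (bisect m a b n l).
Proof.
move=> mP ab; elim: l => // l IH; rewrite ltnS leq_eqVlt => /predU1P[->|kl] ln.
  exact: bisect_step.
by apply: way_below_trans (IH kl (ltnW ln)) _; exact: bisect_step.
Qed.

Definition dyadic (R : realType) (nk : nat * nat) : R := nk.2%:R / 2 ^+ nk.1.

Lemma dyadic_lt (R : realType) n k m l :
  (dyadic R (n, k) < dyadic R (m, l)) = (k * 2 ^ m < l * 2 ^ n)%N.
Proof.
by rewrite /dyadic/= ltr_pdivrMr ?exprn_gt0// mulrAC ltr_pdivlMr ?exprn_gt0//
  -!natrX -!natrM ltr_nat.
Qed.

(** Refining both dyadic numbers to a common denominator reduces the claim to a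
    single level of the bisection; the bound by 1 is there because [bisect]
    takes junk values at [k > 2 ^ n]. *)
Lemma bisect_way_below (R : realType) d (P : porderType d) (m : P -> P -> P)
    (a b : P) i j :
  (forall x y, way_below x y -> way_below x (m x y) /\ way_below (m x y) y) ->
  way_below a b -> dyadic R i < dyadic R j -> dyadic R j <= 1 ->
  way_below (bisect m a b i.1 i.2) (bisect m a b j.1 j.2).
Proof.
case: i j => [n k] [e l] mP ab /=; rewrite dyadic_lt => kl.
rewrite /dyadic/= ler_pdivrMr ?exprn_gt0// mul1r -natrX ler_nat => le.
rewrite -(bisect_refine m a b e n k) -(bisect_refine m a b n e l) addnC.
by apply: bisect_mono => //; rewrite expnD mulnC leq_mul2l le orbT.
Qed.

Lemma dyadic_dense (R : realType) (s t : R) :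
  0 <= s -> s < t -> exists2 i, s < dyadic R i & dyadic R i < t.
Proof.
move=> s0 st; have st0 : 0 < t - s by rewrite subr_gt0.
pose n := Num.bound (t - s)^-1.
have e0 : 0 < 2 ^+ n :> R by rewrite exprn_gt0.
have ne : 1 < (t - s) * 2 ^+ n.
  rewrite mulrC -ltr_pdivrMr// mul1r.
  apply: lt_trans (archi_boundP _) _; first by rewrite invr_ge0 ltW.
  by rewrite -natrX ltr_nat ltn_expl.
have /andP[lo hi] := Num.Theory.truncn_itv (mulr_ge0 s0 (ltW e0)).
exists (n, (Num.truncn (s * 2 ^+ n)).+1); rewrite /dyadic/=.
  by rewrite ltr_pdivlMr.
rewrite ltr_pdivrMr// -natr1; apply: le_lt_trans (lerD lo (lexx 1)) _.
by rewrite -ltrBrDl -mulrBl.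
Qed.

(** * The retract spanned by a chain *)

(** [f p] is the largest level [u] such that [c i << p] for all [i] of level
    below [u]. *)
Lemma level_map (R : realType) d (P : porderType d) (I : Type)
    (r : I -> R) (c : I -> P) :
  (forall i j, 0 < r i -> r i < r j -> r j < 1 -> way_below (c i) (c j)) ->
  exists f : P -> {i01 R},
    (forall i p, 0 < r i -> r i < (f p)%:num -> way_below (c i) p) /\
    (forall i p, 0 < r i -> r i < 1 -> way_below (c i) p -> r i <= (f p)%:num).
Proof.
move=> cc.
pose E p := [set u : {i01 R} |
  forall i, 0 < r i -> r i < u%:num -> way_below (c i) p].
have /choice[f fP] p : exists u, isLub (E p) u.
  apply: i01_dcpo; split.
    by exists (Itv01 (lexx 0) ler01) => i r0 /(lt_trans r0); rewrite ltxx.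
  move=> u v Eu Ev; have [uv|/ltW vu] := leP u%:num v%:num.
    by exists v.
  by exists u.
exists f; split=> i p r0 ri.
  have [_ least] := fP p; apply: contrapT => nci.
  have r1 : r i <= 1 by apply: le_trans (ltW ri) _.
  suff : (f p <= Itv01 (ltW r0) r1)%O by apply/negP; rewrite -ltNge.
  apply: least => u Eu; rewrite leNgt; apply/negP => riu.
  exact: nci (Eu i r0 riu).
move=> cip; have [ub _] := fP p.
apply: (ub (Itv01 (ltW r0) (ltW ri))) => j j0 ji.
exact: way_below_trans (cc _ _ j0 ji ri) cip.
Qed.

Lemma directed_below_level (R : realType) d (P : porderType d) (I : Type)
    (r : I -> R) (c : I -> P) (a : P) (t : {i01 R}) :
  (forall s t, 0 <= s -> s < t -> t <= 1 -> exists2 i, s < r i & r i < t) ->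
  (forall i, 0 < r i -> r i < 1 -> way_below a (c i)) ->
  (forall i j, 0 < r i -> r i < r j -> r j < 1 -> way_below (c i) (c j)) ->
  directed [set x | x = a \/ exists i, [/\ 0 < r i, r i < t%:num & x = c i]].
Proof.
move=> dense ac cc; have t1 : t%:num <= 1 by [].
split=> [|x y]; first by exists a; left.
have ac' i : 0 < r i -> r i < t%:num -> (a <= c i)%O.
  by move=> i0 it; apply/way_below_le/ac => //; apply: lt_le_trans it t1.
move=> [->|[i [i0 it ->]]] [->|[j [j0 jt ->]]].
- by exists a; [left|].
- by exists (c j); [right; exists j|split=> //; exact: ac'].
- by exists (c i); [right; exists i|split=> //; exact: ac'].
(* two indices may have the same level, so an upper bound is sought strictly
   above both *)
have [k mk kt] := dense (Num.max (r i) (r j)) t%:num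
  ltac:(by rewrite le_max (ltW i0)) ltac:(by rewrite gt_max it) t1.
move: mk; rewrite gt_max => /andP[ik jk].
exists (c k); first by right; exists k; split=> //; apply: lt_trans ik.
by split; apply/way_below_le/cc => //; apply: lt_le_trans kt t1.
Qed.

(** The base point [a] is the image of 0, below which there is no chain element.
    Since the levels [r i] are dense, every strict inequality between numbers in
    [0, 1] is witnessed by an index, and all the order claims about [f] reduce
    to way-below relations between the [c i]. *)
Lemma retract_of_way_below_chain (R : realType) d (P : porderType d) (I : Type)
    (r : I -> R) (c : I -> P) (a : P) :
  dcpo P ->
  (forall s t, 0 <= s -> s < t -> t <= 1 -> exists2 i, s < r i & r i < t) ->
  (forall i, 0 < r i -> r i < 1 -> way_below a (c i)) ->
  (forall i j, 0 < r i -> r i < r j -> r j < 1 -> way_below (c i) (c j)) ->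
  (forall i, 0 < r i -> r i < 1 -> ~ compact_elt (c i)) ->
  scott_retract P {i01 R}.
Proof.
move=> dcpoP dense ac cc nc.
have [f [f_wb wb_f]] := level_map cc.
pose B (t : {i01 R}) :=
  [set x | x = a \/ exists i, [/\ 0 < r i, r i < t%:num & x = c i]].
have dB t : directed (B t) by exact: directed_below_level.
have /choice[g gP] t : exists s, isLub (B t) s by exact: dcpoP.
have g0 (t : {i01 R}) : 0 <= t%:num by [].
have g1 (t : {i01 R}) : t%:num <= 1 by [].
have a_g t : (a <= g t)%O by case: (gP t) => ub _; apply: ub; left.
have c_g i t : 0 < r i -> r i < t%:num -> (c i <= g t)%O.
  by move=> i0 it; case: (gP t) => ub _; apply: ub; right; exists i.
have f_mono : {homo f : x y / (x <= y)%O}.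
  move=> p q pq; change ((f p)%:num <= (f q)%:num).
  rewrite leNgt; apply/negP => /(dense _ _ (g0 _)) /(_ (g1 _)) [i qi ip].
  have i0 : 0 < r i := le_lt_trans (g0 _) qi.
  have := wb_f i q i0 (lt_le_trans ip (g1 _))
    (way_below_le_trans (f_wb _ _ i0 ip) pq).
  by rewrite leNgt qi.
have g_mono : {homo g : x y / (x <= y)%O}.
  move=> s t st; case: (gP s) => _; apply=> _ [->|[i [i0 si ->]]] //.
  exact: c_g (lt_le_trans si st).
exists f, g; split.
- split=> // D s dD Ds; split=> [_ [e De <-]|b ubb].
    by apply: f_mono; case: Ds => ub _; exact: ub.
  change ((f s)%:num <= b%:num).
  rewrite leNgt; apply/negP => /(dense _ _ (g0 _)) /(_ (g1 _)) [i bi ifs].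
  (* [c i << s] only gives [c i <= e] for some [e] in [D]; stepping down to
     [c j << c i] turns this into [c j << e] *)
  have [j bj ji] := dense _ _ (g0 b) bi (le_trans (ltW ifs) (g1 _)).
  have j0 : 0 < r j := le_lt_trans (g0 _) bj.
  have i1 : r i < 1 := lt_le_trans ifs (g1 _).
  have [e De cie] := f_wb i s (lt_trans j0 ji) ifs D s dD Ds (lexx s).
  have := wb_f j e j0 (lt_trans ji i1) (way_below_le_trans (cc _ _ j0 ji i1) cie).
  move=> /(lt_le_trans bj); apply/negP; rewrite -leNgt.
  by apply: (ubb (f e)); exists e.
- split=> // D s [[e0 De0] _] [ubs leasts]; split=> [_ [e De <-]|b ubb].
    by apply: g_mono; exact: ubs.
  case: (gP s) => _; apply=> _ [->|[i [i0 si ->]]].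
    by apply: le_trans (a_g e0) _; apply: ubb; exists e0.
  apply: contrapT => nb.
  suff : (s <= Itv01 (ltW i0) (le_trans (ltW si) (g1 s)))%O.
    by apply/negP; rewrite -ltNge.
  apply: leasts => e De; rewrite leNgt; apply/negP => ie; apply: nb.
  by apply: le_trans (c_g _ _ i0 ie) _; apply: ubb; exists e.
- apply/funext => t /=; apply/val_inj => /=; apply/eqP.
  rewrite eq_le; apply/andP; split; rewrite leNgt; apply/negP.
    move=> /(dense _ _ (g0 _)) /(_ (g1 _)) [i ti ifgt].
    have i0 : 0 < r i := le_lt_trans (g0 _) ti.
    have i1 : r i < 1 := lt_le_trans ifgt (g1 _).
    have [x Bx cix] := f_wb _ _ i0 ifgt (B t) (g t) (dB t) (gP t) (lexx _).
    case: Bx cix => [->|[k [k0 kt ->]]] ci.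
      by apply: (nc i) => //; exact: le_way_below_trans ci (ac _ i0 i1).
    apply: (nc i) => //; apply: le_way_below_trans ci _.
    exact: cc (lt_trans kt ti) i1.
  move=> /(dense _ _ (g0 _)) /(_ (g1 _)) [j fj jt].
  have [i fi ij] := dense _ _ (g0 (f (g t))) fj (le_trans (ltW jt) (g1 t)).
  have i0 : 0 < r i := le_lt_trans (g0 _) fi.
  have j1 : r j < 1 := lt_le_trans jt (g1 t).
  have := wb_f i (g t) i0 (lt_trans ij j1)
    (way_below_le_trans (cc _ _ i0 ij j1) (c_g _ _ (lt_trans i0 ij) jt)).
  by rewrite leNgt fi.
Qed.

Theorem mainTheorem1 (R : realType) (d : Order.disp_t) (P : porderType d) :
  domain P -> ~ algebraic P -> scott_retract P {i01 R}.
Proof.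
move=> domP nalgP.
have [a [b [ab free]]] := exists_compact_free_interval domP nalgP.
have /choice[m' mP'] (xy : P * P) : exists z,
    way_below xy.1 xy.2 -> way_below xy.1 z /\ way_below z xy.2.
  have [/(way_below_interpolation domP)[z zP]|nxy] := pselect (way_below xy.1 xy.2).
    by exists z.
  by exists xy.1.
pose m x y := m' (x, y).
have mP x y : way_below x y -> way_below x (m x y) /\ way_below (m x y) y.
  exact: mP' (x, y).
pose c i := bisect m a b i.1 i.2.
have d0 : dyadic R (0, 0)%N = 0 by rewrite /dyadic mul0r.
have d1 : dyadic R (0, 1)%N = 1 by rewrite /dyadic divr1.
have ac i : 0 < dyadic R i -> dyadic R i < 1 -> way_below a (c i).
  move=> i0 i1; apply: (@bisect_way_below R _ _ m a b (0, 0)%N i) => //.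
    by rewrite d0.
  exact: ltW.
have cb i : dyadic R i < 1 -> way_below (c i) b.
  move=> i1; apply: (@bisect_way_below R _ _ m a b i (0, 1)%N) => //; by rewrite d1.
apply: (@retract_of_way_below_chain R _ P _ (dyadic R) c a).
- by case: domP.
- by move=> s t s0 st _; exact: dyadic_dense.
- exact: ac.
- move=> i j _ ij j1; exact: bisect_way_below mP ab ij (ltW j1).
- by move=> i i0 i1; apply: free; apply: way_below_le; [exact: ac|exact: cb].
Qed.
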